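(* Let $L=L(\mathsf X,\mathsf U,\mathcal F)$ and assume the uniform mixing condition with constant $\tau$. Let $\{1,\dots,T\}$ be partitioned into $M$ phases of lengths $\tau_1,\dots,\tau_M$, and let $\widehat{\boldsymbol\gamma}$ be the lazy exponential weights strategy with learning rate $\rho=\sqrt{\frac{2L^2\sum_{i=1}^M\tau_i^2}{\log|\mathsf U|}}$ (where $|\mathsf U|\ge2$ and $L>0$, so that $\rho\in(0,\infty)$). Then for every initial state $x\in\mathsf X$ and every oblivious sequence $\boldsymbol f=(f_1,\dots,f_T)\in\mathcal F^T$, $$\mathbb E_x^{\widehat{\boldsymbol\gamma},\boldsymbol f}\Big[\sum_{t=1}^Tf_t(X_t,U_t)-\Psi(\boldsymbol f)\Big]\le2L\sqrt{2\log|\mathsf U|\sum_{i=1}^M\tau_i^2}+\frac{2C_{\mathcal F}M}{1-e^{-1/\tau}},$$ where $C_{\mathcal F}=\sup_{f\in\mathcal F}\|f\|_\infty$.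
   Context: $\mathsf X,\mathsf U$ are finite nonempty sets (states, actions); $K(y|x,u)$ is a fixed transition kernel; $\mathcal P(\cdot)$ denotes the set of probability distributions on a finite set; $\mathcal M(\mathsf U|\mathsf X)$ is the set of Markov matrices $P=[P(u|x)]$, $P(\cdot|x)\in\mathcal P(\mathsf U)$; $K(y|x,P)=\sum_uK(y|x,u)P(u|x)$, and $\mu K(\cdot|P)$ denotes the distribution $y\mapsto\sum_x\mu(x)K(y|x,P)$. $\|\cdot\|_1$ is the $\ell_1$ norm; $\log$ is natural; $(\pi\otimes P)(x,u)=\pi(x)P(u|x)$; $\langle\nu,f\rangle$ is the expectation of $f$ under $\nu$. Uniform mixing condition: there is a finite constant $\tau\ge1$ such that $\|\mu_1K(\cdot|P)-\mu_2K(\cdot|P)\|_1\le e^{-1/\tau}\|\mu_1-\mu_2\|_1$ for all $P\in\mathcal M(\mathsf U|\mathsf X)$ and $\mu_1,\mu_2\in\mathcal P(\mathsf X)$. In particular each $K(\cdot|\cdot,P)$ has a unique invariant distribution $\pi_P$. ($\tau$ without subscript is this constant; $\tau_i$ are phase lengths.) $\mathcal F$ is a fixed nonempty uniformly bounded class of functions $\mathsf X\times\mathsf U\to\mathbb R$; $T\ge1$ is a fixed horizon. $\widehat Q:\mathsf X\times\mathsf U\to\mathbb R$ satisfies the reverse Poisson inequality for $P$ with forcing function $g$ if for all $(x,u)$ $$\sum_yK(y|x,u)\widehat Q(y,P)-\widehat Q(x,u)\ge -g(x,u)+\langle\pi_P\otimes P,g\rangle,\qquad \widehat Q(y,P)=\sum_{u'}P(u'|y)\widehat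 Q(y,u').$$ Standing assumption: for every $P\in\mathcal M(\mathsf U|\mathsf X)$ and $f\in\mathcal F$ there is a (fixed choice of) function $\widehat Q_{P,f}$ satisfying the reverse Poisson inequality for $P$ with forcing function $f$, and $L(\mathsf X,\mathsf U,\mathcal F)=\sup_{P}\sup_{f\in\mathcal F}\|\widehat Q_{P,f}\|_\infty<\infty$. Game: $X_1=x$. For $t=1,\dots,T$: the agent, using a state feedback law depending only on $f_1,\dots,f_{t-1}$, observes $X_t$ and draws $U_t$ from that law at $X_t$; $f_t$ is revealed; the cost $f_t(X_t,U_t)$ is incurred; $X_{t+1}\sim K(\cdot|X_t,U_t)$. The sequence $\boldsymbol f$ is oblivious: it does not depend on states or actions. The comparator is $\Psi(\boldsymbol f)=\inf_{P\in\mathcal M(\mathsf U|\mathsf X)}\sum_{t=1}^T\langle\pi_P\otimes P,f_t\rangle$. Lazy exponential weights strategy with learning rate $\rho>0$: $\{1,\dots,T\}$ is partitioned into consecutive nonempty contiguous intervals (phases) $\mathcal T_1,\dots,\mathcal T_M$ of lengths $\tau_1,\dots,\tau_M$ with $\sum_i\tau_i=T$. Throughout phase $m$ (all $t\in\mathcal T_m$) the agent uses the fixed state feedback law $$P_m(u|y)=\frac{\exp\big(-\frac1\rho\sum_{i=1}^{m-1}\sum_{s\in\mathcal T_i}h_{y,s}(u)\big)}{\sum_{v\in\mathsf U}\exp\big(-\frac1\rho\sum_{i=1}^{m-1}\sum_{s\in\mathcal T_i}h_{y,s}(v)\big)},\quad y\in\mathsf X,$$ (so $P_1(\cdot|y)$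 is uniform), where for $s\in\mathcal T_i$, $h_{y,s}=\widehat Q_{P_i,f_s}(y,\cdot)$. *)

(* Defs.v *)
From HB Require Import structures.
From mathcomp Require Import all_boot all_order all_algebra.
From mathcomp Require Import all_classical all_reals all_analysis.

Set Implicit Arguments.
Unset Strict Implicit.
Unset Printing Implicit Defensive.

Import Order.TTheory GRing.Theory Num.Theory.
Local Open Scope classical_set_scope.
Local Open Scope ring_scope.

(* Throughout, [K x u y] is K(y|x,u), [P x u] is
   P(u|x), time is counted from 0 (so time t here is round t+1 of the game) and
   so are the phases. *)

Definition is_dist (R : realType) (A : finType) (p : A -> R) : Prop :=
  (forall a, 0 <= p a) /\ \sum_a p a = 1.

Definition is_markov (R : realType) (X U : finType) (P : X -> U -> R) : Prop :=
  forall x, is_dist (P x).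

Definition is_kernel (R : realType) (X U : finType) (K : X -> U -> X -> R) :
    Prop :=
  forall x u, is_dist (K x u).

Definition push (R : realType) (X U : finType) (K : X -> U -> X -> R)
    (P : X -> U -> R) (mu : X -> R) : X -> R :=
  fun y => \sum_x mu x * \sum_u K x u y * P x u.

Definition norm1 (R : realType) (A : finType) (g : A -> R) : R :=
  \sum_a `|g a|.

Definition norm_inf (R : realType) (A : finType) (g : A -> R) : R :=
  \big[Num.max/0]_a `|g a|.

Definition uniform_mixing (R : realType) (X U : finType)
    (K : X -> U -> X -> R) (tau : R) : Prop :=
  forall (P : X -> U -> R) (mu1 mu2 : X -> R),
    is_markov P -> is_dist mu1 -> is_dist mu2 ->
    norm1 (push K P mu1 \- push K P mu2) <=
      expR (- tau^-1) * norm1 (mu1 \- mu2).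

(* The invariant distribution pi_P; an unspecified function if none exists
   (never the case for Markov P, as X is finite), and the unique one under
   [uniform_mixing]. *)
Definition inv_dist (R : realType) (X U : finType) (K : X -> U -> X -> R)
    (P : X -> U -> R) : X -> R :=
  xget (fun=> 0) [set mu : X -> R | is_dist mu /\ push K P mu = mu].

Definition tensor (R : realType) (X U : finType) (mu : X -> R)
    (P : X -> U -> R) : X * U -> R :=
  fun z => mu z.1 * P z.1 z.2.

Definition mean (R : realType) (A : finType) (nu g : A -> R) : R :=
  \sum_a nu a * g a.

Definition reverse_poisson (R : realType) (X U : finType)
    (K : X -> U -> X -> R) (P : X -> U -> R) (g Q : X * U -> R) : Prop :=
  forall x u,
    \sum_y K x u y * (\sum_u' P y u' * Q (y, u')) - Q (x, u) >=
      - g (x, u) + mean (tensor (inv_dist K P) P) g.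

Definition cost_norms (R : realType) (X U : finType) (F : set (X * U -> R)) :
    set R :=
  [set norm_inf f | f in F].

Definition Q_norms (R : realType) (X U : finType) (F : set (X * U -> R))
    (Qhat : (X -> U -> R) -> (X * U -> R) -> X * U -> R) : set R :=
  [set norm_inf (Qhat P f) | P in @is_markov R X U & f in F].

Definition comparator (R : realType) (X U : finType) (K : X -> U -> X -> R)
    (T : nat) (f : 'I_T -> X * U -> R) : R :=
  inf [set \sum_(t < T) mean (tensor (inv_dist K P) P) (f t)
      | P in @is_markov R X U].

(* The probability that the state-action trajectory starts with [w] when the
   initial state has law [mu] and [law t] is the state feedback law at time t. *)
Fixpoint traj_prob (R : realType) (X U : finType) (K : X -> U -> X -> R)
    (mu : X -> R) (law : nat -> X -> U -> R) (w : seq (X * U)) : R :=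
  if w is (x, u) :: w' then
    mu x * law 0%N x u * traj_prob K (K x u) (fun t => law t.+1) w'
  else 1.

Definition expectation_from (R : realType) (X U : finType)
    (K : X -> U -> X -> R) (x : X) (law : nat -> X -> U -> R) (T : nat)
    (Z : T.-tuple (X * U) -> R) : R :=
  \sum_(w : T.-tuple (X * U)) traj_prob K (fun y => (y == x)%:R) law w * Z w.

Definition softmin (R : realType) (X U : finType) (rho : R)
    (S : X * U -> R) : X -> U -> R :=
  fun y u => expR (- (rho^-1 * S (y, u))) /
             \sum_v expR (- (rho^-1 * S (y, v))).

(* Index of the phase containing time t when the horizon is cut into
   consecutive intervals of lengths [len]; see [phaseP]. *)
Definition phase (len : seq nat) (t : nat) : nat := reshape_index len t.

Lemma phaseP (len : seq nat) (t i : nat) :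
  (t < sumn len)%N ->
  (phase len t == i) = (sumn (take i len) <= t < sumn (take i.+1 len))%N.
Proof.
have phase_cons n l k :
    phase (n :: l) k = if (k < n)%N then 0%N else (phase l (k - n)).+1.
  rewrite /phase /reshape_index /= subn_eq0; case: ltnP => //= le_nk.
  by rewrite subSn.
elim: len t i => [|n len IH] t i //= lt_t.
rewrite phase_cons; case: ltnP => [lt_tn|le_nt]; case: i => [|i] //=.
- by rewrite take0 /= addn0 lt_tn.
- apply/esym/negP => /andP[le_t _]; move: lt_tn.
  by rewrite ltnNge (leq_trans (leq_addr _ _) le_t).
- by rewrite take0 /= addn0 ltnNge le_nt.
have lt_t' : (t - n < sumn len)%N by rewrite ltn_subLR.
by rewrite eqSS IH // leq_subRL // ltn_subLR.
Qed.

(* Sum over the first m phases of the functions h; see [lazy_lawE]. *)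
Fixpoint lazy_score (R : realType) (X U : finType)
    (Qhat : (X -> U -> R) -> (X * U -> R) -> X * U -> R) (rho : R)
    (len : seq nat) (T : nat) (f : 'I_T -> X * U -> R) (m : nat) :
    X * U -> R :=
  if m is i.+1 then
    let S := lazy_score Qhat rho len f i in
    fun z => S z +
      \sum_(s < T | phase len s == i) Qhat (softmin rho S) (f s) z
  else fun=> 0.

Definition lazy_law (R : realType) (X U : finType)
    (Qhat : (X -> U -> R) -> (X * U -> R) -> X * U -> R) (rho : R)
    (len : seq nat) (T : nat) (f : 'I_T -> X * U -> R) (m : nat) :
    X -> U -> R :=
  softmin rho (lazy_score Qhat rho len f m).

Definition lazy_strategy (R : realType) (X U : finType)
    (Qhat : (X -> U -> R) -> (X * U -> R) -> X * U -> R) (rho : R)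
    (len : seq nat) (T : nat) (f : 'I_T -> X * U -> R) (t : nat) :
    X -> U -> R :=
  lazy_law Qhat rho len f (phase len t).

Lemma lazy_lawE (R : realType) (X U : finType)
    (Qhat : (X -> U -> R) -> (X * U -> R) -> X * U -> R) (rho : R)
    (len : seq nat) (T : nat) (f : 'I_T -> X * U -> R) (m : nat) y u :
  let P := lazy_law Qhat rho len f in
  let H v := \sum_(i < m) \sum_(s < T | phase len s == i)
               Qhat (P i) (f s) (y, v) in
  P m y u = expR (- (rho^-1 * H u)) / \sum_v expR (- (rho^-1 * H v)).
Proof.
move=> P H.
have SE v : lazy_score Qhat rho len f m (y, v) = H v.
  rewrite /H; elim: m {H} => [|m IH] /=; first by rewrite big_ord0.
  by rewrite big_ord_recr /= IH.
by rewrite /P /lazy_law /softmin SE; under eq_bigr do rewrite SE.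
Qed.

(* Main.v *)
(* Inside a phase the law of the state contracts geometrically towards the
   invariant distribution of the policy in force, so replacing the true expected
   cost by the stationary one loses at most 2 C / (1 - exp (- 1 / tau)) per
   phase.  Averaging the reverse Poisson inequality over the stationary
   state-action law of a comparator P bounds the stationary cost difference by
   the pi_P-average over y of <P_m(.|y) - P(.|y), h_y>: at each state y this is
   the regret of exponential weights over M rounds with losses of size at most
   L tau_i. *)

Require Import Defs.
From mathcomp Require Import all_boot all_order all_algebra.
From mathcomp Require Import all_classical all_reals all_analysis.
From mathcomp Require Import ring lra.

Import Order.TTheory GRing.Theory Num.Theory.
Local Open Scope classical_set_scope.
Local Open Scope ring_scope.

Set Implicit Arguments.
Unset Strict Implicit.

(** * Invariant distributions of finite Markov chains *)

(** Unit row sums mean that [A] fixes the all-ones column. The transpose appears because [det0P]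
    speaks of row vectors killed from the left. *)
Lemma det_stochastic_sub1 (R : realType) (n : nat) (A : 'M[R]_n.+1) :
  (forall i, \sum_j A i j = 1) -> \det (A - 1%:M) = 0.
Proof.
move=> A1; rewrite -det_tr; apply/eqP/det0P; exists (const_mx 1).
  by apply/eqP => /rowP/(_ 0); rewrite !mxE => /eqP; rewrite oner_eq0.
rewrite -[const_mx 1]trmxK trmx_const -trmx_mul; apply/rowP => i; rewrite !mxE.
under eq_bigr do rewrite !mxE mulr1.
rewrite sumrB A1 (bigD1 i) //= eqxx big1 ?addr0 ?subrr // => j.
by rewrite eq_sym => /negPf ->.
Qed.

(* The pointwise absolute value of a left eigenvector for the eigenvalue 1 is
   subinvariant, hence invariant since both sides have the same mass. *)
Lemma stationary_dist_exists (R : realType) (X : finType) (x0 : X)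
    (A : X -> X -> R) :
  is_markov A ->
  exists mu : X -> R, is_dist mu /\ forall y, \sum_x mu x * A x y = mu y.
Proof.
move=> hA; have [n cX] : {n | #|X| = n.+1}.
  by exists #|X|.-1; rewrite prednK //; apply/card_gt0P; exists x0.
pose e (i : 'I_n.+1) : X := enum_val (cast_ord (esym cX) i).
have e_bij : bijective e.
  apply: bij_comp; first exact: enum_val_bij.
  by exists (cast_ord cX) => i; rewrite ?cast_ordK ?cast_ordKV.
have sumE (g : X -> R) : \sum_x g x = \sum_i g (e i).
  by rewrite (reindex e) //; apply: onW_bij.
(* Singularity is now read on the other side: [v] is a nonzero row fixed by the transition matrix,
   with entries of unknown sign. *)
have /eqP/det0P[v v0 vA] : \det (\matrix_(i, j) A (e i) (e j) - 1%:M) = 0.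
  apply: det_stochastic_sub1 => i; under eq_bigr do rewrite mxE.
  by rewrite -(sumE (A (e i))); case: (hA (e i)).
have [d de ed] := e_bij.
pose w x : R := `|v 0 (d x)|.
have w_sub y : w y <= \sum_x w x * A x y.
  have : v 0 (d y) = \sum_x v 0 (d x) * A x y.
    move: vA; rewrite mulmxBr mulmx1 => /eqP; rewrite subr_eq0 => /eqP.
    move=> /rowP/(_ (d y)) <-; rewrite mxE sumE; apply: eq_bigr => i _.
    by rewrite mxE de ed.
  rewrite /w => ->; apply: le_trans (ler_norm_sum _ _ _) _.
  apply: ler_sum => x _; rewrite normrM [`|A x y|]ger0_norm //.
  by case: (hA x).
have w_inv y : \sum_x w x * A x y = w y.
  apply/eqP; rewrite -subr_eq0; apply/eqP.
  apply: (@psumr_eq0P _ _ xpredT (fun y => \sum_x w x * A x y - w y)) => //.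
    by move=> z _; rewrite subr_ge0.
  rewrite sumrB exchange_big /= -sumrB big1 // => x _.
  by rewrite -mulr_sumr; case: (hA x) => _ ->; rewrite mulr1 subrr.
have w_gt0 : 0 < \sum_x w x.
  rewrite lt_neqAle sumr_ge0 ?andbT => [|x _]; last exact: normr_ge0.
  apply: contra v0 => /eqP/esym s0; apply/eqP/rowP => i.
  have := @psumr_eq0P _ _ xpredT w (fun x _ => normr_ge0 _) s0 (e i) isT.
  by rewrite /w de mxE => /normr0_eq0.
exists (fun x => w x / \sum_x w x); split; first split.
- by move=> x; rewrite divr_ge0 ?normr_ge0 // ltW.
- by rewrite -mulr_suml divff // gt_eqF.
- move=> y; rewrite -w_inv mulr_suml; apply: eq_bigr => x _.
  by rewrite mulrAC.
Qed.

(** Once some invariant distribution exists, [xget] returns one instead of its default value; [x0]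
    witnesses that there is a state. *)
Lemma inv_distP (R : realType) (X U : finType) (x0 : X) (K : X -> U -> X -> R)
    (P : X -> U -> R) :
  is_kernel K -> is_markov P ->
  is_dist (inv_dist K P) /\ push K P (inv_dist K P) = inv_dist K P.
Proof.
move=> hK hP.
rewrite /inv_dist; apply: (@xgetPex _ _
  [set mu : X -> R | is_dist mu /\ push K P mu = mu]).
have [|mu [mu_dist mu_inv]] :=
    @stationary_dist_exists R X x0 (fun x y => \sum_u K x u y * P x u).
  move=> x; split=> [y|].
    by apply: sumr_ge0 => u _; rewrite mulr_ge0 ?(hK x u).1 ?(hP x).1.
  rewrite exchange_big /=; under eq_bigr do rewrite -mulr_suml (hK x _).2 mul1r.
  exact: (hP x).2.
by exists mu; split=> //; apply/funext => y; apply: mu_inv.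
Qed.

(** * State laws, trajectory probabilities and the expected cost *)

Lemma push_dist (R : realType) (X U : finType) (K : X -> U -> X -> R)
    (P : X -> U -> R) (mu : X -> R) :
  is_kernel K -> is_markov P -> is_dist mu -> is_dist (push K P mu).
Proof.
move=> hK hP [mu0 mu1]; split=> [y|].
  apply: sumr_ge0 => x _; rewrite mulr_ge0 //.
  by apply: sumr_ge0 => u _; rewrite mulr_ge0 ?(hK x u).1 ?(hP x).1.
rewrite /push exchange_big /= -mu1; apply: eq_bigr => x _.
rewrite -mulr_sumr exchange_big /=.
under eq_bigr do rewrite -mulr_suml (hK x _).2 mul1r.
by rewrite (hP x).2 mulr1.
Qed.

Fixpoint state_law (R : realType) (X U : finType) (K : X -> U -> X -> R)
    (mu : X -> R) (law : nat -> X -> U -> R) (t : nat) : X -> R :=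
  if t is t'.+1 then push K (law t') (state_law K mu law t') else mu.

Lemma state_law_dist (R : realType) (X U : finType) (K : X -> U -> X -> R)
    (mu : X -> R) (law : nat -> X -> U -> R) (t : nat) :
  is_kernel K -> (forall t, is_markov (law t)) -> is_dist mu ->
  is_dist (state_law K mu law t).
Proof. by move=> hK hl hmu; elim: t => //= t IH; apply: push_dist. Qed.

(** [state_law] appends the last transition whereas [traj_prob] peels off the first; this first-step
    decomposition reconciles the two recursions. *)
Lemma state_law_step (R : realType) (X U : finType) (K : X -> U -> X -> R)
    (mu : X -> R) (law : nat -> X -> U -> R) (t : nat) (y : X) :
  state_law K mu law t.+1 y =
  \sum_(z : X * U) mu z.1 * law 0%N z.1 z.2 *
    state_law K (K z.1 z.2) (fun s => law s.+1) t y.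
Proof.
elim: t y => [|t IH] y.
  rewrite -(pair_bigA _ (fun x u => mu x * law 0%N x u * K x u y)).
  apply: eq_bigr => x _; rewrite mulr_sumr; apply: eq_bigr => u _ /=.
  by rewrite -mulrA [K _ _ _ * _]mulrC.
have -> : state_law K mu law t.+2 y =
    \sum_x state_law K mu law t.+1 x * \sum_u K x u y * law t.+1 x u by [].
under eq_bigr do rewrite IH mulr_suml.
rewrite exchange_big; apply: eq_bigr => z _ /=.
by rewrite mulr_sumr; apply: eq_bigr => x _; rewrite mulrA.
Qed.

Lemma big_tuple_cons (R : nmodType) (A : finType) (n : nat)
    (g : n.+1.-tuple A -> R) :
  \sum_w g w = \sum_a \sum_(w : n.-tuple A) g [tuple of a :: w].
Proof.
rewrite pair_bigA /=; pose h (p : A * n.-tuple A) := [tuple of p.1 :: p.2].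
apply: reindex; exists (fun w => (thead w, [tuple of behead w])).
  by move=> [a w] _; congr pair; apply: val_inj.
by move=> w _; rewrite [RHS]tuple_eta; apply: val_inj.
Qed.

Lemma traj_prob_sum1 (R : realType) (X U : finType) (K : X -> U -> X -> R)
    (mu : X -> R) (law : nat -> X -> U -> R) (T : nat) :
  is_kernel K -> (forall t, is_markov (law t)) -> is_dist mu ->
  \sum_(w : T.-tuple (X * U)) traj_prob K mu law w = 1.
Proof.
move=> hK; elim: T mu law => [|T IH] mu law hl hmu.
  rewrite (bigD1 [tuple]) //= big1 ?addr0 // => w.
  by rewrite tuple0.
rewrite big_tuple_cons; transitivity (\sum_x \sum_u
    \sum_(w : T.-tuple (X * U)) traj_prob K mu law ((x, u) :: w)).
  by rewrite [RHS]pair_bigA; apply: eq_bigr => -[x u].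
rewrite -hmu.2; apply: eq_bigr => x _.
under eq_bigr do rewrite -mulr_sumr IH // mulr1.
by rewrite -mulr_sumr (hl 0%N x).2 mulr1.
Qed.

(** Induction on [T], conditioning on the first pair [(x, u)]: the rest of the trajectory starts
    from [K x u] and uses the feedback laws shifted by one. *)
Lemma expected_cost (R : realType) (X U : finType) (K : X -> U -> X -> R)
    (mu : X -> R) (law : nat -> X -> U -> R) (T : nat)
    (f : 'I_T -> X * U -> R) :
  is_kernel K -> (forall t, is_markov (law t)) -> is_dist mu ->
  \sum_(w : T.-tuple (X * U)) traj_prob K mu law w * \sum_t f t (tnth w t) =
  \sum_(t < T) mean (tensor (state_law K mu law t) (law t)) (f t).
Proof.
move=> hK; elim: T mu law f => [|T IH] mu law f hl hmu.
  by rewrite big_ord0 big1 // => w _; rewrite big_ord0 mulr0.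
rewrite big_tuple_cons big_ord_recl.
under [X in _ = _ + X]eq_bigr do rewrite lift0.
transitivity (\sum_(z : X * U) (mu z.1 * law 0%N z.1 z.2 * f ord0 z +
   mu z.1 * law 0%N z.1 z.2 * \sum_(t < T) mean (tensor (state_law K
     (K z.1 z.2) (fun s => law s.+1) t) (law t.+1)) (f (lift ord0 t)))).
  apply: eq_bigr => -[x u] _ /=.
  rewrite -(IH (K x u) (fun s => law s.+1) (fun t => f (lift ord0 t))) //.
  (* The immediate cost is multiplied by the total mass 1 of the continuations, so that both terms
     become sums over tails. *)
  rewrite -mulrDr -[f ord0 _]mul1r.
  rewrite -(@traj_prob_sum1 R X U K (K x u) (fun s => law s.+1) T) //.
  rewrite mulr_suml -big_split mulr_sumr; apply: eq_bigr => w _ /=.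
  rewrite -mulrDr mulrA big_ord_recl tnth0; congr (_ * (_ + _)).
  by apply: eq_bigr => t _; rewrite tnthS.
rewrite big_split; congr (_ + _).
(* For the later costs, averaging the conditional state laws over the first pair gives back the
   unconditional one. *)
under eq_bigr do rewrite mulr_sumr.
rewrite exchange_big; apply: eq_bigr => t _.
rewrite /mean /tensor; under [RHS]eq_bigr do rewrite state_law_step !mulr_suml.
under eq_bigr do rewrite mulr_sumr.
rewrite exchange_big; apply: eq_bigr => z _; apply: eq_bigr => z' _.
by rewrite !mulrA.
Qed.

(** * Exponential moments and the regret of exponential weights *)

Lemma le_norm_inf (R : realType) (A : finType) (g : A -> R) (a : A) :
  `|g a| <= norm_inf g.
Proof. exact: le_bigmax. Qed.

(* Squaring [expR (- z / 2) >= 1 - z / 2] gives this, because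
   (1 - z / 2)^2 (1 + z + 2 z^2) - 1 = z^2 (1 - z) (5 - 2 z) / 4. *)
Lemma expR_le_quad (R : realType) (z : R) :
  z <= 1 -> expR z <= 1 + z + 2 * z ^+ 2.
Proof.
move=> z1; have h0 : 0 < 1 - z / 2 by lra.
have := expR_ge1Dx (- (z / 2)); rewrite expRN => hE.
have [e0 eE] : 0 < expR (z / 2) /\ expR z = expR (z / 2) ^+ 2.
  by rewrite expR_gt0 -expRM_natl; split=> //; congr expR; field.
rewrite eE; have he : expR (z / 2) * (1 - z / 2) <= 1.
  by rewrite mulrC -ler_pdivlMr // div1r.
have hsq : (expR (z / 2) * (1 - z / 2)) ^+ 2 <= 1.
  by rewrite expr_le1 // mulr_ge0 // ltW.
rewrite -(@ler_pM2r _ ((1 - z / 2) ^+ 2)) ?exprn_gt0 // -exprMn.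
apply: le_trans hsq _; rewrite -subr_ge0.
rewrite (_ : _ - 1 = z ^+ 2 * (1 - z) * (5 - 2 * z) / 4); last by field.
apply: divr_ge0 => //; apply: mulr_ge0; last by lra.
by apply: mulr_ge0; [exact: sqr_ge0 | lra].
Qed.

(** For [b <= 1], average [expR_le_quad] and use [1 + s <= expR s]. For larger [b] the crude bound
    [expR b] suffices, since the mean is at least [- b] and [b <= - b + 2 * b ^+ 2]. *)
Lemma exp_moment_le (R : realType) (U : finType) (p z : U -> R) (b : R) :
  is_dist p -> (forall u, `|z u| <= b) ->
  \sum_u p u * expR (z u) <= expR (mean p z + 2 * b ^+ 2).
Proof.
move=> [p0 p1] zb; have [b1|/ltW b1] := leP b 1.
  apply: le_trans (expR_ge1Dx _).
  have -> : 1 + (mean p z + 2 * b ^+ 2) =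
      \sum_u p u * (1 + z u + 2 * b ^+ 2).
    under eq_bigr do rewrite !mulrDr mulr1.
    by rewrite !big_split /= -mulr_suml p1 mul1r addrA.
  apply: ler_sum => u _.
  apply: ler_wpM2l => //; have := zb u; rewrite ler_norml => /andP[zl zr].
  apply: le_trans (expR_le_quad (le_trans zr b1)) _.
  by rewrite lerD2l; nra.
apply: (@le_trans _ _ (expR b)).
  rewrite -[leRHS]mul1r -p1 mulr_suml; apply: ler_sum => u _.
  by apply: ler_wpM2l => //; rewrite ler_expR; apply: le_trans (ler_norm _) _.
have mz : - b <= mean p z.
  rewrite -[leLHS]mul1r -p1 mulr_suml; apply: ler_sum => u _.
  by apply: ler_wpM2l => //; have := zb u; rewrite ler_norml => /andP[].
by rewrite ler_expR; nra.
Qed.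

Lemma sum_expR_gt0 (R : realType) (U : finType) (g : U -> R) :
  (0 < #|U|)%N -> 0 < \sum_u expR (g u).
Proof.
move=> /card_gt0P[u0 _]; rewrite (bigD1 u0) //=; apply: ltr_wpDr.
  by apply: sumr_ge0 => u _; apply: expR_ge0.
exact: expR_gt0.
Qed.

Lemma softmin_markov (R : realType) (X U : finType) (rho : R)
    (S : X * U -> R) :
  (0 < #|U|)%N -> is_markov (softmin rho S).
Proof.
move=> hU y; have W0 := sum_expR_gt0 (fun v => - (rho^-1 * S (y, v))) hU.
split=> [u|]; first by rewrite divr_ge0 ?expR_ge0 // ltW.
by rewrite -mulr_suml divff // gt_eqF.
Qed.

(* Potential argument: each phase multiplies the total weight
   W = \sum_u expR (- S u / rho) by the p-expectation of expR (- l / rho). *)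
Lemma exp_weights_regret (R : realType) (U : finType) (rho : R) (M : nat)
    (p l : nat -> U -> R) (b : nat -> R) (u0 : U) :
  0 < rho ->
  (forall m, (m < M)%N -> forall u, `|l m u| <= b m) ->
  (forall m u, p m u = expR (- (rho^-1 * \sum_(i < m) l i u)) /
     \sum_v expR (- (rho^-1 * \sum_(i < m) l i v))) ->
  \sum_(m < M) mean (p m) (l m) - \sum_(m < M) l m u0 <=
  rho * ln #|U|%:R + 2 / rho * \sum_(m < M) b m ^+ 2.
Proof.
move=> rho0 lb pE.
pose W m : R := \sum_v expR (- (rho^-1 * \sum_(i < m) l i v)).
have hU : (0 < #|U|)%N by apply/card_gt0P; exists u0.
have W0 m : 0 < W m by apply: sum_expR_gt0.
have p_dist m : is_dist (p m).
  split=> [u|]; first by rewrite pE divr_ge0 ?expR_ge0 // ltW // W0.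
  by under eq_bigr do rewrite pE; rewrite -mulr_suml divff // gt_eqF // W0.
have U0 : 0 < #|U|%:R :> R by rewrite ltr0n.
(* The initial weight is [#|U|], all scores being zero; each round then contributes one factor,
   bounded by [exp_moment_le] with [z = - l m / rho] and bound [b m / rho]. *)
have W_le m : (m <= M)%N -> W m <= #|U|%:R *
    expR (- (\sum_(i < m) mean (p i) (l i)) / rho +
          2 / rho ^+ 2 * \sum_(i < m) b i ^+ 2).
  elim: m => [_|m IH mM].
    rewrite /W !big_ord0 oppr0 mul0r mulr0 addr0 expR0 mulr1.
    by under eq_bigr do rewrite big_ord0 mulr0 oppr0 expR0; rewrite sumr_const.
  have WS : W m.+1 = W m * \sum_u p m u * expR (- l m u / rho).
    rewrite mulr_sumr; apply: eq_bigr => u _; rewrite pE -/(W m) big_ord_recr /=.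
    rewrite !mulrA [W m * _]mulrC mulfK ?gt_eqF ?W0 // -expRD; congr expR.
    ring.
  have step : \sum_u p m u * expR (- l m u / rho) <=
      expR (- mean (p m) (l m) / rho + 2 / rho ^+ 2 * b m ^+ 2).
    have := @exp_moment_le R U (p m) (fun u => - l m u / rho) (b m / rho)
      (p_dist m).
    rewrite expr_div_n [2 * _]mulrA mulrAC /mean => h.
    rewrite -sumrN mulr_suml; under [X in X + _]eq_bigr do rewrite -mulrN -mulrA.
    apply: h => u; rewrite normrM normrN [`|rho^-1|]ger0_norm ?invr_ge0 ?(ltW rho0) //.
    by rewrite ler_pM2r ?invr_gt0 // lb.
  rewrite WS; apply: le_trans (ler_pM (ltW (W0 m)) _ (IH (ltnW mM)) step) _.
    by apply: sumr_ge0 => u _; rewrite mulr_ge0 ?expR_ge0 // (p_dist m).1.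
  rewrite -[leLHS]mulrA ler_pM2l // -expRD ler_expR !big_ord_recr /=.
  by rewrite le_eqVlt; apply/orP; left; apply/eqP; ring.
(* Keeping only the comparator action [u0] bounds the final weight from below. *)
have W_ge : expR (- (rho^-1 * \sum_(i < M) l i u0)) <= W M.
  rewrite /W (bigD1 u0) //= lerDl; apply: sumr_ge0 => v _; exact: expR_ge0.
have := le_trans W_ge (W_le M (leqnn M)).
(* With [#|U|] written as the exponential of its logarithm, the exponents can be compared;
   multiplying by [rho] turns them into costs. *)
rewrite -[X in X * expR _]lnK ?posrE // -expRD ler_expR.
rewrite -(@ler_pM2l _ rho) // => h.
set A := \sum_(m < M) mean _ _; set B := \sum_(m < M) l _ _.
set V := \sum_(m < M) b _ ^+ 2.
move: h; rewrite -/A -/B -/V mulrN mulVKf ?gt_eqF // !mulrDr.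
rewrite (_ : rho * (- A / rho) = - A); last by field; rewrite gt_eqF.
rewrite (_ : rho * (2 / rho ^+ 2 * V) = 2 / rho * V); last by field; rewrite gt_eqF.
by lra.
Qed.

(** * Sums over phases *)

Lemma sumn_takeS (len : seq nat) (i : nat) :
  sumn (take i.+1 len) = (sumn (take i len) + nth 0 len i)%N.
Proof.
have [ltis|leis] := ltnP i (size len); first by rewrite (take_nth 0%N) ?sumn_rcons.
by rewrite nth_default // addn0 !take_oversize // ltnW.
Qed.

Lemma sum_in_phase (V : nmodType) (len : seq nat) (i : nat) (g : nat -> V) :
  \sum_(t < sumn len | phase len t == i) g t =
  \sum_(k < nth 0%N len i) g (sumn (take i len) + k)%N.
Proof.
set a := sumn (take i len); set n := nth 0%N len i.
under eq_bigl => t do rewrite (phaseP _ (ltn_ord t)) sumn_takeS -/a -/n.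
rewrite -(big_mkord (fun t => a <= t < a + n)%N g).
rewrite -(big_nat_widen _ _ _ (fun t => a <= t)%N); last first.
  by rewrite -sumn_takeS -[X in (_ <= sumn X)%N](cat_take_drop i.+1) sumn_cat leq_addr.
rewrite -(big_nat_widenl _ _ _ xpredT) // -{1}[a]add0n big_addn addKn big_mkord.
by apply: eq_bigr => k _; rewrite addnC.
Qed.

Lemma phase_lt (len : seq nat) (t : nat) :
  (t < sumn len)%N -> (phase len t < size len)%N.
Proof.
move=> lt_t; rewrite ltnNge; apply/negP => le_s.
(* For an index past the last phase, [take] returns all of [len], and [phaseP] would force
   [sumn len <= t]. *)
have := phaseP (phase len t) lt_t; rewrite eqxx take_oversize //.
by rewrite leqNgt lt_t.
Qed.

Lemma sum_by_phase (V : nmodType) (len : seq nat) (g : 'I_(sumn len) -> V) :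
  \sum_t g t = \sum_(i < size len) \sum_(t < sumn len | phase len t == i) g t.
Proof.
rewrite (exchange_big_dep xpredT) //=; apply: eq_bigr => t _.
by rewrite (big_pred1 (Ordinal (phase_lt (ltn_ord t)))) // => i; rewrite eq_sym.
Qed.

(** * Mixing inside a phase, stationary costs and the transient loss *)

Lemma norm1_dist_sub_le2 (R : realType) (A : finType) (p q : A -> R) :
  is_dist p -> is_dist q -> norm1 (p \- q) <= 2.
Proof.
move=> [p0 p1] [q0 q1].
rewrite (_ : 2 = \sum_a (p a + q a)); last by rewrite big_split /= p1 q1.
apply: ler_sum => a _ /=; apply: le_trans (ler_normB _ _) _.
by rewrite !ger0_norm.
Qed.

(** Since [pi] is fixed by the policy in force from time [a] on, each step applies the mixing
    condition to the current law and [pi]. The constant 2 is the largest distance between two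
    distributions. *)
Lemma norm1_state_law_le (R : realType) (X U : finType) (K : X -> U -> X -> R)
    (tau : R) (mu pi : X -> R) (law : nat -> X -> U -> R) (P : X -> U -> R)
    (a n k : nat) :
  is_kernel K -> uniform_mixing K tau -> (forall t, is_markov (law t)) ->
  is_markov P -> is_dist mu -> is_dist pi -> push K P pi = pi ->
  (forall j, (j < n)%N -> law (a + j)%N = P) -> (k <= n)%N ->
  norm1 (state_law K mu law (a + k) \- pi) <= 2 * expR (- tau^-1) ^+ k.
Proof.
move=> hK hmix hl hP hmu hpi pi_inv lawP.
elim: k => [_|k IH kn].
  by rewrite expr0 mulr1; apply: norm1_dist_sub_le2 => //; apply: state_law_dist.
rewrite addnS /= lawP // -{1}pi_inv exprS mulrCA.
apply: le_trans (hmix _ _ _ hP _ hpi) _; first exact: state_law_dist.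
by rewrite ler_pM2l ?expR_gt0 // IH // ltnW.
Qed.

Lemma mean_tensorE (R : realType) (X U : finType) (mu : X -> R)
    (P : X -> U -> R) (g : X * U -> R) :
  mean (tensor mu P) g = \sum_x mu x * mean (P x) (fun u => g (x, u)).
Proof.
transitivity (\sum_x \sum_u mu x * P x u * g (x, u)).
  by rewrite [RHS]pair_bigA; apply: eq_bigr => -[x u].
by apply: eq_bigr => x _; rewrite mulr_sumr; apply: eq_bigr => u _; rewrite mulrA.
Qed.

Lemma tensor_dist (R : realType) (X U : finType) (mu : X -> R)
    (P : X -> U -> R) :
  is_dist mu -> is_markov P -> is_dist (tensor mu P).
Proof.
move=> [mu0 mu1] hP; split=> [[x u]|]; first by rewrite mulr_ge0 ?(hP x).1 ?mu0.
transitivity (mean (tensor mu P) (fun=> 1)).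
  by apply: eq_bigr => z _; rewrite mulr1.
rewrite mean_tensorE -[RHS]mu1; apply: eq_bigr => x _.
by rewrite /mean; under eq_bigr do rewrite mulr1; rewrite (hP x).2 mulr1.
Qed.

(** Both state laws are followed by the same [P], so the action-averaged cost is a function of the
    state bounded by [C], and only [mu \- pi] remains. *)
Lemma mean_tensor_sub_le (R : realType) (X U : finType) (mu pi : X -> R)
    (P : X -> U -> R) (g : X * U -> R) (C : R) :
  is_markov P -> norm_inf g <= C ->
  mean (tensor mu P) g - mean (tensor pi P) g <= C * norm1 (mu \- pi).
Proof.
move=> hP gC; rewrite !mean_tensorE -sumrB mulr_sumr.
apply: ler_sum => x _ /=; rewrite -mulrBl.
apply: le_trans (ler_norm _) _; rewrite normrM mulrC.
apply: ler_wpM2r => //; rewrite -[leRHS]mul1r -(hP x).2 mulr_suml.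
apply: le_trans (ler_norm_sum _ _ _) _; apply: ler_sum => u _.
rewrite normrM [`|P x u|]ger0_norm ?(hP x).1 //.
by apply: ler_wpM2l; [exact: (hP x).1 | apply: le_trans (le_norm_inf _ _) gC].
Qed.

(* Average the reverse Poisson inequality for P' over the invariant
   state-action law of P. *)
Lemma steady_cost_sub_le (R : realType) (X U : finType) (K : X -> U -> X -> R)
    (P P' : X -> U -> R) (pi : X -> R) (g Q : X * U -> R) :
  is_markov P -> is_dist pi -> push K P pi = pi ->
  reverse_poisson K P' g Q ->
  mean (tensor (inv_dist K P') P') g - mean (tensor pi P) g <=
  \sum_y pi y * (mean (P' y) (fun u => Q (y, u)) -
                 mean (P y) (fun u => Q (y, u))).
Proof.
move=> hP hpi pi_inv hQ; set c := mean (tensor (inv_dist K P') P') g.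
have [nu0 nu1] := tensor_dist hpi hP.
pose V y := mean (P' y) (fun u => Q (y, u)).
(* Invariance of [pi] under [P] replaces [V] by its one-step expectation; everything is then
   averaged against the same state-action weights, and the Poisson inequality applies pointwise. *)
have VE : \sum_y pi y * V y =
    mean (tensor pi P) (fun z => \sum_y K z.1 z.2 y * V y).
  rewrite mean_tensorE -{1}pi_inv /push.
  under eq_bigr do rewrite mulr_suml.
  rewrite exchange_big; apply: eq_bigr => x _ /=.
  under eq_bigr do rewrite -mulrA; rewrite -mulr_sumr; congr (_ * _).
  under eq_bigr do rewrite mulr_suml.
  rewrite exchange_big; apply: eq_bigr => u _ /=; rewrite mulr_sumr.
  by apply: eq_bigr => y _; rewrite mulrAC mulrC.
under eq_bigr do rewrite mulrBr.
rewrite sumrB -(mean_tensorE pi P Q) VE /mean -[c]mul1r -nu1 mulr_suml -!sumrB.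
apply: ler_sum => -[x u] _; rewrite -!mulrBr; apply: ler_wpM2l => //=.
by have := hQ x u; rewrite addrC.
Qed.

Lemma geometric_sum_le (R : realType) (a : R) (n : nat) :
  0 <= a < 1 -> \sum_(k < n) a ^+ k <= (1 - a)^-1.
Proof.
move=> /andP[a0 a1]; have h : 0 < 1 - a by rewrite subr_gt0.
rewrite -[leRHS]mul1r ler_pdivlMr //.
by have := subrX1 a n; have := exprn_ge0 n a0; lra.
Qed.

Lemma transient_cost_le (R : realType) (X U : finType) (K : X -> U -> X -> R)
    (tau : R) (mu : X -> R) (P : nat -> X -> U -> R) (len : seq nat) (C : R)
    (f : 'I_(sumn len) -> X * U -> R) (x0 : X) :
  let law t := P (phase len t) in
  is_kernel K -> 0 < tau -> uniform_mixing K tau ->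
  (forall m, is_markov (P m)) -> is_dist mu ->
  (forall t, norm_inf (f t) <= C) -> 0 <= C ->
  \sum_(t < sumn len) mean (tensor (state_law K mu law t) (law t)) (f t) -
  \sum_(t < sumn len) mean (tensor (inv_dist K (law t)) (law t)) (f t) <=
  2 * C * (size len)%:R / (1 - expR (- tau^-1)).
Proof.
move=> law hK tau0 hmix hP hmu fC C0; set a := expR (- tau^-1).
have a01 : 0 <= a < 1.
  by rewrite expR_ge0 -expR0 ltr_expR oppr_lt0 invr_gt0.
rewrite -sumrB sum_by_phase.
rewrite mulrAC mulr_natr -[in leRHS](card_ord (size len)) -sumr_const.
apply: ler_sum => i _; set s := sumn (take i len).
(* Here [t - s] is the time elapsed since the phase began; the resulting series is geometric in
   it. *)
apply: (@le_trans _ _ (\sum_(t < sumn len | phase len t == i)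
    C * (2 * a ^+ (t - s)))).
  apply: ler_sum => t ti; have := ti.
  rewrite phaseP // sumn_takeS -/s => /andP[st tn].
  apply: le_trans (mean_tensor_sub_le _ _ (hP _) (fC t)) _.
  apply: ler_wpM2l => //; rewrite -{1}(subnKC st).
  have [pi_dist pi_inv] := inv_distP x0 hK (hP (phase len t)).
  apply: (norm1_state_law_le hK hmix _ (hP (phase len t)) hmu pi_dist pi_inv
    (n := nth 0%N len i)) => [|j ji|]; first by move=> ?; apply: hP.
    (* The times [s + j] with [j] below the phase length lie in the same phase; [phaseP] also asks
       that they precede the horizon, because a prefix sum is at most the whole sum. *)
    rewrite /law (eqP ti); congr P; apply/eqP; rewrite phaseP.
      by rewrite sumn_takeS leq_addr ltn_add2l.
    apply: leq_trans (_ : sumn (take i.+1 len) <= _)%N.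
      by rewrite sumn_takeS ltn_add2l.
    by rewrite -[X in (_ <= sumn X)%N](cat_take_drop i.+1) sumn_cat leq_addr.
  by rewrite leq_subLR ltnW.
rewrite (sum_in_phase _ _ (fun t => C * (2 * a ^+ (t - s)))) -/s.
under eq_bigr do rewrite addKn.
rewrite -!mulr_sumr mulrA [C * 2]mulrC; apply: ler_wpM2l; first exact: mulr_ge0.
exact: geometric_sum_le.
Qed.

(** * Regret of the lazy strategy at a fixed state *)

(** The policy is frozen during a phase, so the losses of a phase add up to a single round [l m] of
    exponential weights, of size at most [L] times the phase length. *)
Lemma lazy_regret (R : realType) (X U : finType)
    (Qhat : (X -> U -> R) -> (X * U -> R) -> X * U -> R) (rho L : R)
    (len : seq nat) (f : 'I_(sumn len) -> X * U -> R) (P : X -> U -> R)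
    (y : X) :
  let law := lazy_strategy Qhat rho len f in
  0 < rho -> is_markov P ->
  (forall (t : 'I_(sumn len)) z, `|Qhat (law t) (f t) z| <= L) ->
  \sum_(t < sumn len) (mean (law t y) (fun u => Qhat (law t) (f t) (y, u)) -
          mean (P y) (fun u => Qhat (law t) (f t) (y, u))) <=
  rho * ln #|U|%:R +
  2 / rho * (L ^+ 2 * \sum_(i < size len) (nth 0%N len i)%:R ^+ 2).
Proof.
move=> law rho0 hP QL; pose Pm := lazy_law Qhat rho len f.
pose l m u := \sum_(s < sumn len | phase len s == m) Qhat (Pm m) (f s) (y, u).
(* Stated for any phase-indexed family [p], so that it serves both the played laws and the constant
   comparator. *)
have meanE (p : nat -> U -> R) :
    \sum_(t < sumn len) mean (p (phase len t)) (fun u => Qhat (law t) (f t) (y, u)) =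
    \sum_(m < size len) mean (p m) (l m).
  rewrite sum_by_phase; apply: eq_bigr => m _.
  rewrite [RHS]/mean; under [RHS]eq_bigr do rewrite mulr_sumr.
  rewrite [RHS]exchange_big; apply: eq_bigr => t /eqP tm.
  by rewrite /law /lazy_strategy tm.
rewrite sumrB (meanE (fun m => Pm m y)) (meanE (fun=> P y)).
set A := \sum_(m < size len) _; set B := leRHS.
have [P0 P1] := hP y.
(* The regret is affine in the comparator, so it is an average over [P y] of regrets against fixed
   actions. *)
have -> (c : R) : c - \sum_(m < size len) mean (P y) (l m) =
    \sum_u P y u * (c - \sum_(m < size len) l m u).
  under [RHS]eq_bigr do rewrite mulrBr mulr_sumr.
  by rewrite sumrB -mulr_suml P1 mul1r exchange_big.
rewrite -[B]mul1r -P1 mulr_suml; apply: ler_sum => u _.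
apply: ler_wpM2l => //; rewrite /A /B.
have := @exp_weights_regret R U rho (size len) (fun m => Pm m y) l
  (fun m => L * (nth 0%N len m)%:R) u rho0 => regret.
apply: le_trans (regret _ _) _ => {regret}.
- move=> m _ v; apply: le_trans (ler_norm_sum _ _ _) _.
  apply: (@le_trans _ _ (\sum_(s < sumn len | phase len s == m) L)).
    apply: ler_sum => t /eqP tm; rewrite -tm; exact: QL.
  by rewrite (sum_in_phase _ _ (fun=> L)) sumr_const card_ord mulr_natr.
- by move=> m v; rewrite /Pm lazy_lawE.
- under eq_bigr do rewrite exprMn.
  by rewrite -mulr_sumr.
Qed.

(** * Tuning of the learning rate and final assembly *)

Unset Implicit Arguments.
Set Strict Implicit.

Theorem theorem4 (R : realType) (X U : finType) (hU : (2 <= #|U|)%N)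
  (K : X -> U -> X -> R) (hK : is_kernel K)
  (tau : R) (htau : 1 <= tau) (hmix : uniform_mixing K tau)
  (F : set (X * U -> R)) (hF0 : F !=set0) (hFb : has_ubound (cost_norms F))
  (Qhat : (X -> U -> R) -> (X * U -> R) -> X * U -> R)
  (hQ : forall P f, is_markov P -> F f -> reverse_poisson K P f (Qhat P f))
  (hQb : has_ubound (Q_norms F Qhat))
  (T : nat) (hT : (1 <= T)%N)
  (M : nat) (len : M.-tuple nat)
  (hlen : forall i : 'I_M, (0 < tnth len i)%N)
  (hsum : (\sum_(i < M) tnth len i)%N = T) :
  let L := sup (Q_norms F Qhat) in
  let C := sup (cost_norms F) in
  let S2 : R := \sum_(i < M) (tnth len i)%:R ^+ 2 in
  let logU : R := ln #|U|%:R in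
  let rho := Num.sqrt (2 * L ^+ 2 * S2 / logU) in
  0 < L ->
  forall (x : X) (f : 'I_T -> X * U -> R), (forall t, F (f t)) ->
  expectation_from K x (lazy_strategy Qhat rho len f)
    (fun w : T.-tuple (X * U) =>
       (\sum_(t < T) f t (tnth w t)) - comparator K f)
  <= 2 * L * Num.sqrt (2 * logU * S2) + 2 * C * M%:R / (1 - expR (- tau^-1)).
Proof.
move=> L C S2 logU rho L0 x.
have {hsum} hsum : sumn len = T.
  by rewrite -hsum sumnE big_tuple.
subst T => f hf.
(* A horizon of at least one round forces at least one phase, whence [S2] and [rho] are positive. *)
have M0 : (0 < M)%N by case: M len {hlen S2 rho f hf} hT => // len; rewrite tuple0.
have S2_gt0 : 0 < S2.
  rewrite /S2 (bigD1 (Ordinal M0)) //=; apply: ltr_wpDr.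
    by apply: sumr_ge0 => i _; apply: sqr_ge0.
  by rewrite exprn_gt0 // ltr0n.
have logU_gt0 : 0 < logU by rewrite ln_gt0 // ltr1n.
have rho_arg : 0 < 2 * L ^+ 2 * S2 / logU.
  by rewrite divr_gt0 // !mulr_gt0 // exprn_gt0.
have rho0 : 0 < rho by rewrite sqrtr_gt0.
(* This choice of [rho] balances the regret bound: the entropy term [rho * logU] equals the
   quadratic term [2 / rho * (L ^+ 2 * S2)]. *)
have rho2 : rho ^+ 2 * logU = 2 * L ^+ 2 * S2.
  by rewrite sqr_sqrtr ?(ltW rho_arg) // divfK // gt_eqF.
have sqrtE : L * Num.sqrt (2 * logU * S2) = rho * logU.
  rewrite -(ger0_norm (ltW L0)) -(ger0_norm (ltW (mulr_gt0 rho0 logU_gt0))).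
  rewrite -!sqrtr_sqr -sqrtrM ?sqr_ge0 //; congr Num.sqrt.
  have -> : (rho * logU) ^+ 2 = rho ^+ 2 * logU * logU by ring.
  by rewrite rho2; ring.
set law := lazy_strategy Qhat rho len f.
have hU0 : (0 < #|U|)%N by apply: leq_trans hU.
have hPm m : is_markov (lazy_law Qhat rho len f m) by apply: softmin_markov.
have hlaw t : is_markov (law t) by apply: hPm.
have fC t : norm_inf (f t) <= C by apply: (ub_le_sup hFb); exists (f t).
have C0 : 0 <= C.
  case: hF0 => g hg; apply: le_trans (_ : norm_inf g <= C).
    by apply: bigmax_ge_id.
  by apply: (ub_le_sup hFb); exists g.
have QL (t : 'I_(sumn len)) z : `|Qhat (law t) (f t) z| <= L.
  apply: le_trans (le_norm_inf _ _) _; apply: (ub_le_sup hQb).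
  by exists (law t) => //; exists (f t).
have delta_dist : is_dist (fun y => (y == x)%:R : R).
  split=> [y|]; first exact: ler0n.
  by rewrite (bigD1 x) //= eqxx big1 ?addr0 // => y /negPf ->.
(* The comparator does not depend on the trajectory, so it leaves the expectation with total mass
   1. *)
rewrite /expectation_from; under eq_bigr do rewrite mulrBr.
rewrite sumrB -mulr_suml traj_prob_sum1 // mul1r expected_cost //.
(* With the infimum isolated on the larger side, it suffices to bound each of its members from
   below; [law 0%N] shows that there is one. *)
rewrite lerBlDr -lerBlDl; apply: lb_le_inf.
  by eexists; exists (law 0%N) => //; apply: hlaw.
move=> _ [P hP <-].
have transient := transient_cost_le x hK (lt_le_trans ltr01 htau) hmix hPm
  delta_dist fC C0.
have [pi_dist pi_inv] := inv_distP x hK hP.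
(* The stationary gap is averaged over the invariant law of [P] alone, with the same weights at all
   times, so the sums over time and state can be exchanged and the regret bounded state by state. *)
have regret : \sum_(t < sumn len) mean (tensor (inv_dist K (law t)) (law t)) (f t)
    - \sum_(t < sumn len) mean (tensor (inv_dist K P) P) (f t) <=
    rho * logU + rho * logU.
  rewrite -sumrB; apply: le_trans (ler_sum _ _) _.
    by move=> t _; apply: (steady_cost_sub_le hP pi_dist pi_inv (hQ _ _ (hlaw t) (hf t))).
  rewrite exchange_big /= -[leRHS]mul1r -pi_dist.2 mulr_suml.
  apply: ler_sum => y _; rewrite -mulr_sumr; apply: ler_wpM2l.
    exact: pi_dist.1.
  apply: le_trans (lazy_regret y rho0 hP QL) _; rewrite -/logU.
  have -> : \sum_(i < size len) (nth 0%N len i)%:R ^+ 2 = S2.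
    rewrite size_tuple; by apply: eq_bigr => i _; rewrite (tnth_nth 0%N).
  have -> : 2 / rho * (L ^+ 2 * S2) = rho * logU.
    rewrite (_ : _ * _ = rho^-1 * (2 * L ^+ 2 * S2)); last by ring.
    by rewrite -rho2 expr2 !mulrA mulVf ?mul1r // gt_eqF.
  by [].
move: transient regret; rewrite size_tuple -/law -[2 * L * _]mulrA sqrtE.
by lra.
Qed.
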